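(* Let $A$ be a semisimple Banach algebra and let $a,b\in\mathrm{Soc}(A)$. Then $\rho(a,b)=0$ if and only if $\rho(b,a)=0$.
   Context: Banach algebras are over $\mathbb{C}$ and have a unit $1$. For $a,b\in A$ let $C_{a,b}:A\to A$ be the bounded operator $C_{a,b}x=ax-xb$, and put $\rho(a,b)=\limsup_{n\to\infty}\|C_{a,b}^n1\|^{1/n}$. $\mathrm{Soc}(A)$ (the socle) is the two-sided ideal of all finite sums of rank one elements, where $0\neq u\in A$ is rank one if $uAu\subseteq\mathbb{C}u$ (the zero element is included as the empty sum). *)

(* Defs.v *)
From mathcomp Require Import all_boot all_order all_algebra.
From mathcomp Require Import complex.
From mathcomp Require Import all_classical all_reals all_analysis.

Set Implicit Arguments.
Unset Strict Implicit.
Unset Printing Implicit Defensive.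

Import Order.TTheory GRing.Theory Num.Theory.
Import numFieldNormedType.Exports.
Import ComplexField.Normc.

Local Open Scope classical_set_scope.
Local Open Scope ring_scope.

(* [nrm] makes the unital algebra [A] a complex Banach algebra; the norm of 1
   is not required to be 1. The norm is an explicit function because
   Hierarchy-Builder rejects a structure extending both [algType] and
   [normedModType] (no join below [numDomainType]). Nonnegativity and
   [nrm 0 = 0] follow from [ban_scale] and [ban_triangle]. *)
Record banach_algebra_norm (R : realType) (A : algType R[i]) (nrm : A -> R)
    : Prop := BanachAlgebraNorm {
  ban_eq0 : forall x, nrm x = 0 -> x = 0;
  ban_triangle : forall x y, nrm (x + y) <= nrm x + nrm y;
  ban_scale : forall (c : R[i]) x, nrm (c *: x) = normc c * nrm x;
  ban_submul : forall x y, nrm (x * y) <= nrm x * nrm y;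
  ban_complete : forall u : nat -> A,
    (forall e : R, 0 < e -> exists N : nat, forall m n : nat,
       (N <= m)%N -> (N <= n)%N -> nrm (u m - u n) < e) ->
    exists l : A, (fun n => nrm (u n - l)) @ \oo --> (0 : R)
}.

Definition left_ideal (A : nzRingType) (I : set A) : Prop :=
  [/\ I 0,
      forall x y, I x -> I y -> I (x + y)
    & forall c x, I x -> I (c * x)].

Definition maximal_left_ideal (A : nzRingType) (I : set A) : Prop :=
  [/\ left_ideal I,
      I <> setT
    & forall J, left_ideal J -> I `<=` J -> J <> setT -> J = I].

Definition jacobson_radical (A : nzRingType) : set A :=
  \bigcap_(I in @maximal_left_ideal A) I.
Arguments jacobson_radical : clear implicits.

(* Semisimplicity in the Banach algebra sense (trivial radical), which does
   not entail that [A] is artinian. *)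
Definition semisimple (A : nzRingType) : Prop :=
  jacobson_radical A = [set 0].

Definition rank_one (K : numFieldType) (A : algType K) (u : A) : Prop :=
  u != 0 /\ forall x : A, exists c : K, u * x * u = c *: u.

Definition Soc (K : numFieldType) (A : algType K) : set A :=
  [set x | exists s : seq A,
     (forall u, u \in s -> rank_one u) /\ x = \sum_(u <- s) u].
Arguments Soc {K} A.

Definition Cop (A : nzRingType) (a b : A) : A -> A :=
  fun x => a * x - x * b.

Definition rho (R : realType) (A : algType R[i]) (nrm : A -> R) (a b : A)
    : \bar R :=
  limn_esup (fun n : nat => (nrm (iter n (Cop a b) 1) `^ n%:R^-1)%:E).

(* Main.v *)
Require Import Defs.
From mathcomp Require Import all_boot all_order all_algebra.
From mathcomp Require Import complex ring zify.
From mathcomp Require Import all_classical all_reals all_analysis.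

Import Order.TTheory GRing.Theory Num.Theory.
Import numFieldNormedType.Exports.
Import ComplexField.Normc.

Local Open Scope classical_set_scope.
Local Open Scope ring_scope.

(** The equivalence holds because an element of the socle is algebraic over the
scalars, and for algebraic elements the condition [rho a b = 0] says something
symmetric.

Algebraicity. Let [a] be the sum of rank one elements [u_1, ..., u_k]. In a
product of such letters a factor [u_i w u_i] collapses to a multiple of [u_i],
so the span of the finitely many words without repeated letter is stable under
left multiplication by [a]. It contains 1, hence all powers of [a], and [a] is a
root of a nonzero polynomial ([Soc_algebraic]).

Symmetry. Choose [P], a product of factors [(X - z)^m] over distinct [z],
that annihilates both [a] and [b]. The Chinese remainder theorem gives
polynomials [e_z] whose values at [a] and at [b] are the spectral idempotents of
[a] and [b] ([spectral_idempotent_polys]). If [z <> y] and [e_z(a) e_y(b)] were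
nonzero, some [x = u v], with [u] a polynomial in [a] and [v] a polynomial in
[b], would be a simultaneous eigenvector: [a x = z x] and [x b = y x]. Then
[u C_{a,b}^n(1) v = C_{a,b}^n(x) = (z - y)^n x], which forces
[rho a b >= |z - y| > 0] ([rho_eq0_eigen]). So [rho a b = 0] implies
[e_z(a) e_y(b) = 0] for [z <> y]; as both families sum to 1, this means
[e_z(a) = e_z(b)] for all [z]. Conversely, if the idempotents agree, then
[C_{b,a}] is nilpotent on each of them, being a difference of two commuting
nilpotent multiplications there, hence a power of [C_{b,a}] kills 1, their sum,
and [rho b a = 0]. *)

(** * Algebraicity of the socle *)

(** A relation between the coordinates of [1, a, ..., a^d], where [d] is the
size of the spanning family, is the coefficient vector of [p]. *)
Lemma algebraic_of_finite_span (K : fieldType) (A : algType K) (I : finType)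
    (v : I -> A) (a : A) :
  (forall n, exists c : I -> K, a ^+ n = \sum_i c i *: v i) ->
  exists2 p : {poly K}, p != 0 & horner_alg a p = 0.
Proof.
move=> /choice[c cE].
pose M : 'M[K]_(#|I|.+1, #|I|) := \matrix_(n, i) c n (enum_val i).
have : kermx M != 0.
  by rewrite kermx_eq0 -row_leq_rank -ltnNge ltnS rank_leq_col.
case/rowV0Pn=> w /sub_kermxP wM w0; exists (rVpoly w).
  by apply: contra_neq w0 => w0; rewrite -[w]rVpolyK w0 linear0.
have -> : rVpoly w = \sum_(k < #|I|.+1) w 0 k *: 'X^k.
  by rewrite /rVpoly poly_def; apply: eq_bigr => k _; rewrite valK.
rewrite linear_sum /=.
transitivity (\sum_(k < #|I|.+1) \sum_i (w 0 k * c k i) *: v i).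
  apply: eq_bigr => k _; rewrite linearZ rmorphXn /= horner_algX mulr_algl.
  by rewrite cE scaler_sumr; apply: eq_bigr => i _; rewrite scalerA.
rewrite exchange_big big1 //= => i _; rewrite -scaler_suml.
have /matrixP/(_ 0 (enum_rank i)) := wM; rewrite !mxE => wMi.
rewrite [X in X *: _](_ : _ = 0) ?scale0r // -[RHS]wMi.
by apply: eq_bigr => k _; rewrite mxE enum_rankK.
Qed.

(** The spanning family for [algebraic_of_finite_span] consists of the words
without repeated letter in the rank one summands of [a]. *)
Lemma Soc_algebraic (K : numFieldType) (A : algType K) (a : A) :
  Soc A a -> exists2 p : {poly K}, p != 0 & horner_alg a p = 0.
Proof.
case=> s [s1 ->]; set k := size s.
pose word (t : seq 'I_k) : A := \prod_(i <- t) s`_i.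
(* A word over ['I_k] without repetition has length at most [k], so bounded
   sequences form a finite type that enumerates all of them. *)
pose V (x : A) := exists c : k.-bseq 'I_k -> K,
  x = \sum_(t : k.-bseq 'I_k) c t *: (if uniq t then word t else 0).
have VD x y : V x -> V y -> V (x + y).
  move=> [c ->] [d ->]; exists (fun t => c t + d t).
  by rewrite -big_split; apply: eq_bigr => t _; rewrite scalerDl.
have VZ l x : V x -> V (l *: x).
  move=> [c ->]; exists (fun t => l * c t).
  by rewrite scaler_sumr; apply: eq_bigr => t _; rewrite scalerA.
have V0 : V 0.
  by exists (fun=> 0); rewrite big1 // => t _; rewrite scale0r.
have Vword t : uniq t -> V (word t).
  move=> ut; have szt : (size t <= k)%N.
    by rewrite -(card_uniqP ut) -[leqRHS]card_ord max_card.
  exists (fun t' => (t' == Bseq szt)%:R).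
  rewrite (bigD1 (Bseq szt)) //= eqxx scale1r ut big1 ?addr0 // => t' /negPf ->.
  by rewrite scale0r.
have Vletter i t : uniq t -> V (s`_i * word t).
  case: (ltnP i k) => [ik|ki _]; last first.
    by rewrite nth_default // mul0r; exact: V0.
  move=> ut; have [it|it] := boolP (Ordinal ik \in t); last first.
    have -> : s`_i * word t = word (Ordinal ik :: t) by rewrite /word big_cons.
    by apply: Vword; rewrite /= it.
  (* If the letter already occurs, everything before that occurrence is
     absorbed into a scalar. *)
  have [t1 [t2 tE]] : exists t1 t2, t = t1 ++ Ordinal ik :: t2.
    by case/splitPr: it => t1 t2; exists t1, t2.
  have [_ /(_ (word t1))[l lE]] := s1 _ (mem_nth 0 ik).
  have -> : s`_i * word t = l *: word (Ordinal ik :: t2).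
    by rewrite tE /word big_cat !big_cons /= !mulrA lE scalerAl.
  apply/VZ/Vword; move: ut; by rewrite tE cat_uniq => /and3P[_ _].
have Vmul x : V x -> V ((\sum_(u <- s) u) * x).
  move=> [c ->]; rewrite mulr_sumr; elim/big_ind: _ => // t _.
  rewrite -scalerAr; apply: VZ; case: ifP => [ut|_]; last by rewrite mulr0.
  rewrite (big_nth 0) mulr_suml; elim/big_ind: _ => // i _; exact: Vletter.
apply: (@algebraic_of_finite_span _ _ _
  (fun t : k.-bseq 'I_k => if uniq t then word t else 0)).
elim=> [|n IHn]; last by rewrite exprS; apply: Vmul.
by rewrite expr0; have := Vword [::] isT; rewrite /word big_nil.
Qed.

(** * Spectral idempotents as polynomials *)

Lemma poly_dvd_prod_linear_powers (K : closedFieldType) (p : {poly K}) :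
  p != 0 ->
  exists s : seq K, exists m : nat,
    uniq s /\ p %| \prod_(z <- s) ('X - z%:P) ^+ m.
Proof.
have [r pE] := closed_field_poly_normal p => p0.
exists (undup r), (size r); split; first exact: undup_uniq.
rewrite pE dvdpZl ?lead_coef_eq0 // -big_undup_iterop_count /=.
elim: (undup r) => [|z s IHs]; first by rewrite !big_nil.
by rewrite !big_cons dvdp_mul // (dvdp_exp2l _ (count_size _ _)).
Qed.

(** At any [c] annihilated by the product [P] of the [(X - z)^m], the values
[e z] form a partition of 1 into elements killed by [(c - z)^m]: these are the
spectral idempotents of [c]. Keeping the sum congruent to 1 modulo [P], instead
of equal to it, makes the empty product a valid base case. *)
Lemma spectral_idempotent_polys (K : fieldType) (s : seq K) (m : nat) :
  uniq s ->
  exists e : K -> {poly K},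
    (\prod_(z <- s) ('X - z%:P) ^+ m %| \sum_(z <- s) e z - 1) /\
    forall z, z \in s ->
      \prod_(y <- s) ('X - y%:P) ^+ m %| ('X - z%:P) ^+ m * e z.
Proof.
elim: s => [_|z0 s IHs /= /andP[z0s us]].
  by exists (fun=> 0); split=> //; rewrite big_nil dvd1p.
have [e [esum edvd]] := IHs us.
set P := \prod_(z <- s) _ in esum edvd; set Q := ('X - z0%:P) ^+ m.
have /Bezout_eq1_coprimepP[[u v] /= uv1] : coprimep P Q.
  rewrite /P big_seq; elim/big_rec: _ => [|z x zs xQ]; first exact: coprime1p.
  rewrite coprimepMl xQ andbT coprimep_expl // coprimep_expr //.
  by rewrite coprimep_XsubC2 // subr_eq0; apply: contraNneq z0s => ->.
exists (fun z => if z == z0 then u * P else v * Q * e z); split.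
  rewrite !big_cons eqxx.
  have -> : \sum_(z <- s) (if z == z0 then u * P else v * Q * e z)
          = v * Q * \sum_(z <- s) e z.
    rewrite mulr_sumr !big_seq; apply: eq_bigr => z zs.
    by rewrite ifN //; apply: contraNneq z0s => <-.
  have -> : u * P + v * Q * (\sum_(z <- s) e z) - 1
          = v * (Q * (\sum_(z <- s) e z - 1)).
    by rewrite -[X in _ - X = _]uv1; ring.
  by rewrite dvdp_mull // dvdp_mul.
move=> z; rewrite big_cons in_cons -/Q -/P.
have [-> _|_ /= zs] := eqVneq z z0; first by rewrite mulrCA dvdp_mull.
have -> : ('X - z%:P) ^+ m * (v * Q * e z) = v * (Q * (('X - z%:P) ^+ m * e z)).
  by ring.
by rewrite dvdp_mull // dvdp_mul // edvd.
Qed.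

(** * Iterates of the operator [Cop] *)

(** Left multiplication by [u] and right multiplication by [v] commute with
both terms of [Cop a b]. *)
Lemma iter_Cop_intertwine (A : nzRingType) (a b u v x : A) (n : nat) :
  a * u = u * a -> b * v = v * b ->
  iter n (Cop a b) (u * x * v) = u * iter n (Cop a b) x * v.
Proof.
move=> au bv; elim: n => //= n ->; rewrite /Cop mulrBr mulrBl.
by rewrite !mulrA au -!mulrA bv.
Qed.

(** The [n]-th iterate is the binomial combination of the [a^i x b^j] with
[i + j = n]. The hypothesis ranges over [i + j >= n] so that it passes to
[Cop a b x] in the induction. *)
Lemma iter_Cop_eq0 (A : nzRingType) (a b x : A) (n : nat) :
  (forall i j, (n <= i + j)%N -> a ^+ i * x * b ^+ j = 0) ->
  iter n (Cop a b) x = 0.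
Proof.
elim: n x => [|n IHn] x abx.
  by have := abx 0 0 isT; rewrite mul1r mulr1.
rewrite iterSr IHn // => i j nij; rewrite /Cop mulrBr mulrBl.
have := abx i.+1 j; rewrite exprSr addSn !mulrA => -> //.
by have := abx i j.+1; rewrite exprS addnS !mulrA => -> //; rewrite subrr.
Qed.

Lemma Cop_shift (K : fieldType) (A : algType K) (a b x : A) (l : K) :
  Cop (a - l%:A) (b - l%:A) x = Cop a b x.
Proof.
rewrite /Cop mulrBl mulrBr mulr_algl mulr_algr opprB.
by rewrite addrA subrK.
Qed.

Lemma iter_Cop_eigen (K : fieldType) (A : algType K) (a b y : A) (l m : K)
    (n : nat) :
  a * y = l *: y -> y * b = m *: y ->
  iter n (Cop a b) y = (l - m) ^+ n *: y.
Proof.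
move=> ay yb; elim: n => [|n IHn]; first by rewrite scale1r.
rewrite iterS IHn /Cop -scalerAr -scalerAl ay yb -scalerBr -scalerBl.
by rewrite scalerA exprSr.
Qed.

(** * Vanishing of the local spectral radius *)

Lemma nrm0 (R : realType) (A : algType R[i]) (nrm : A -> R)
    (hnrm : banach_algebra_norm nrm) :
  nrm 0 = 0.
Proof. by rewrite -(scale0r (0 : A)) (ban_scale hnrm) normc0 mul0r. Qed.

Lemma nrm_ge0 (R : realType) (A : algType R[i]) (nrm : A -> R)
    (hnrm : banach_algebra_norm nrm) x :
  0 <= nrm x.
Proof.
have := ban_triangle hnrm x (- x); rewrite subrr (nrm0 _ _ _ hnrm) -scaleN1r.
by rewrite (ban_scale hnrm) normcN normc1 mul1r -mulr2n pmulrn_lge0.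
Qed.

Lemma normcX (R : realType) (c : R[i]) n : normc (c ^+ n) = normc c ^+ n.
Proof. by elim: n => [|n IHn]; rewrite ?normc1 // !exprS normcM IHn. Qed.

Lemma rho_eq0_nilpotent (R : realType) (A : algType R[i]) (nrm : A -> R)
    (hnrm : banach_algebra_norm nrm) (a b : A) n :
  iter n (Cop a b) 1 = 0 -> rho nrm a b = 0%:E.
Proof.
move=> C0; rewrite /rho (cvg_limn_einf_sup (l := 0%:E)) //.
apply: cvg_near_cst; exists n.+1 => // k /= nk.
have k0 : (0 < k)%N by exact: leq_trans nk.
have -> : iter k (Cop a b) 1 = 0.
  rewrite -(subnK (ltnW nk)) iterD C0; elim: (_ - _)%N => //= j ->.
  by rewrite /Cop mulr0 mul0r subrr.
by rewrite (nrm0 _ _ _ hnrm) powR0 // invr_eq0 pnatr_eq0 -lt0n.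
Qed.

(** A limit superior zero of nonnegative terms is a limit, so the [n]-th roots
are eventually below any [d]. *)
Lemma rho_eq0_bound (R : realType) (A : algType R[i]) (nrm : A -> R)
    (hnrm : banach_algebra_norm nrm) (a b : A) (d : R) :
  rho nrm a b = 0%:E -> 0 < d ->
  \forall n \near \oo, nrm (iter n (Cop a b) 1) <= d ^+ n.
Proof.
move=> r0 d0.
have /fine_cvgP[_ /cvgr_lt/(_ d d0)[N _ Nd]] :
    (nrm (iter n (Cop a b) 1) `^ n%:R^-1)%:E @[n --> \oo] --> 0%:E.
  apply: limn_esup_le_cvg => [|n]; last by rewrite lee_fin powR_ge0.
  by rewrite -[X in (X <= _)%E]/(rho nrm a b) r0.
exists N.+1 => // n /= Nn.
have n0 : (0 < n)%N by exact: leq_trans Nn.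
have /= := Nd n (ltnW Nn); set t := nrm _ => /ltW td.
rewrite -[t]powRr1 ?(nrm_ge0 _ _ _ hnrm) //.
rewrite -[X in _ `^ X](@mulVf _ n%:R) ?pnatr_eq0 -?lt0n //.
by rewrite powRrM powR_mulrn ?powR_ge0 // lerXn2r ?nnegrE ?powR_ge0 // ltW.
Qed.

(** Since [u * v] is an eigenvector of [Cop a b] of the form [u * 1 * v], the
iterates at 1 grow at least like [|l - m|^n] if [u * v] is nonzero. *)
Lemma rho_eq0_eigen (R : realType) (A : algType R[i]) (nrm : A -> R)
    (hnrm : banach_algebra_norm nrm) (a b u v : A) (l m : R[i]) :
  rho nrm a b = 0%:E -> l != m ->
  a * u = u * a -> b * v = v * b ->
  a * (u * v) = l *: (u * v) -> u * v * b = m *: (u * v) -> u * v = 0.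
Proof.
move=> r0 lm au bv al bm; apply: (ban_eq0 hnrm); apply/eqP.
rewrite eq_le (nrm_ge0 _ _ _ hnrm) andbT leNgt; apply/negP => y0.
set d := normc (l - m); set K := nrm u * nrm v.
have d0 : 0 < d.
  rewrite lt_def; apply/andP; split; last first.
    by rewrite /d; case: (l - m) => ? ?; exact: sqrtr_ge0.
  by apply: contra_neq lm => /eq0_normc /eqP; rewrite subr_eq0 => /eqP.
(* Comparison with the rate [d / 2] gives [2^n |u v| <= |u| |v|] for large [n],
   contradicted by [n] above [|u| |v| / |u v|]. *)
have d20 : 0 < d / 2 by rewrite divr_gt0.
have [N _ Nd] := rho_eq0_bound _ _ _ hnrm _ _ (d / 2) r0 d20.
set n := maxn N (Num.bound (K / nrm (u * v))).
have le1 : d ^+ n * nrm (u * v) <= K * (d / 2) ^+ n.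
  rewrite -normcX -(ban_scale hnrm) -(iter_Cop_eigen _ _ a b) //.
  rewrite -{1}[u]mulr1 iter_Cop_intertwine //.
  apply: le_trans (ban_submul hnrm _ _) _; rewrite /K mulrAC.
  rewrite ler_wpM2r ?(nrm_ge0 _ _ _ hnrm) //.
  apply: le_trans (ban_submul hnrm _ _) _.
  by rewrite ler_wpM2l ?(nrm_ge0 _ _ _ hnrm) // Nd //= leq_maxl.
have : 2 ^+ n * nrm (u * v) <= K.
  rewrite -(ler_pM2l (exprn_gt0 n d0)) mulrCA [_ * K]mulrC.
  move: le1; rewrite expr_div_n [K * _]mulrA ler_pdivlMr ?exprn_gt0 //.
  by rewrite [_ * 2 ^+ n]mulrC.
rewrite leNgt => /negP; apply; rewrite -ltr_pdivrMr //.
apply: lt_le_trans (archi_boundP _) _.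
  by rewrite divr_ge0 ?mulr_ge0 ?(nrm_ge0 _ _ _ hnrm).
rewrite -natrX ler_nat; apply: leq_trans (ltnW (ltn_expl n (ltnSn 1))).
exact: leq_maxr.
Qed.

(** * Symmetry for algebraic elements *)

Lemma horner_alg_comm (K : fieldType) (A : algType K) (a : A) (p : {poly K}) :
  a * horner_alg a p = horner_alg a p * a.
Proof. by rewrite -{1 4}[a]horner_algX -!rmorphM mulrC. Qed.

Lemma horner_alg_dvd (K : fieldType) (A : algType K) (a : A) (p q : {poly K}) :
  p %| q -> horner_alg a p = 0 -> horner_alg a q = 0.
Proof. by move=> /dvdpP[h ->] pa; rewrite rmorphM /= pa mulr0. Qed.

Lemma horner_algXsubC (K : fieldType) (A : algType K) (a : A) (l : K) :
  horner_alg a ('X - l%:P) = a - l%:A.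
Proof. by rewrite rmorphB /= horner_algX horner_algC. Qed.

(** Vanishing of [rho a b] makes the spectral idempotents of [a] and [b] equal;
this equality is symmetric and makes a power of [Cop b a] kill 1. *)
Lemma rho_eq0_algebraic_sym (R : realType) (A : algType R[i]) (nrm : A -> R)
    (a b : A) (p q : {poly R[i]}) :
  banach_algebra_norm nrm ->
  p != 0 -> q != 0 -> horner_alg a p = 0 -> horner_alg b q = 0 ->
  rho nrm a b = 0%:E -> rho nrm b a = 0%:E.
Proof.
move=> hnrm p0 q0 pa qb r0.
have [s [m [us pqP]]] := poly_dvd_prod_linear_powers _ _ (mulf_neq0 p0 q0).
have [e [esum edvd]] := spectral_idempotent_polys _ _ m us.
set P := \prod_(z <- s) _ in pqP esum edvd.
have Pa : horner_alg a P = 0.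
  exact: horner_alg_dvd (dvdp_trans (dvdp_mulr _ (dvdpp p)) pqP) pa.
have Pb : horner_alg b P = 0.
  exact: horner_alg_dvd (dvdp_trans (dvdp_mull _ (dvdpp q)) pqP) qb.
have sum1 (c : A) : horner_alg c P = 0 -> \sum_(z <- s) horner_alg c (e z) = 1.
  move=> /(horner_alg_dvd _ _ _ _ _ esum) /eqP.
  by rewrite rmorphB rmorph1 subr_eq0 rmorph_sum => /eqP.
have kill (c : A) z i : horner_alg c P = 0 -> z \in s -> (m <= i)%N ->
    horner_alg c (('X - z%:P) ^+ i * e z) = 0.
  move=> Pc zs mi; apply: horner_alg_dvd Pc.
  by rewrite -(subnK mi) exprD -mulrA dvdp_mull // edvd.
have orth l n : l \in s -> n \in s -> l != n ->
    horner_alg a (e l) * horner_alg b (e n) = 0.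
  move=> ls ns ln.
  (* Descending induction on [i + j]: the product vanishes once one exponent
     reaches [m], and if it vanishes after raising either exponent, then it is a
     simultaneous eigenvector, to which [rho_eq0_eigen] applies. *)
  suff main k i j : (m + m <= i + j + k)%N ->
      horner_alg a (('X - l%:P) ^+ i * e l) *
      horner_alg b (('X - n%:P) ^+ j * e n) = 0.
    by have := main (m + m)%N 0 0 (leqnn _); rewrite !mul1r.
  elim: k i j => [|k IHk] i j.
    rewrite addn0 => mij; have [mi|im] := leqP m i.
      by rewrite (kill a l i) // mul0r.
    by rewrite (kill b n j) ?mulr0 //; lia.
  rewrite addnS => mij; apply: (rho_eq0_eigen _ _ _ hnrm a b _ _ l n) => //.
  - exact: horner_alg_comm.
  - exact: horner_alg_comm.
  - have := IHk i.+1 j mij; rewrite exprS -mulrA rmorphM /= horner_algXsubC.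
    by rewrite -mulrA mulrBl mulr_algl => /eqP; rewrite subr_eq0 => /eqP.
  - have := IHk i j.+1; rewrite addnS => /(_ mij).
    rewrite exprS -mulrA [horner_alg b _]rmorphM /= horner_algXsubC.
    rewrite mulrBl horner_alg_comm mulr_algl mulrBr mulrA -scalerAr.
    by move=> /eqP; rewrite subr_eq0 => /eqP.
have eab z : z \in s -> horner_alg a (e z) = horner_alg b (e z).
  move=> zs; transitivity (horner_alg a (e z) * horner_alg b (e z)).
    rewrite -[LHS]mulr1 -(sum1 b Pb) mulr_sumr (bigD1_seq z) //=.
    rewrite big_seq_cond big1 ?addr0 // => y /andP[ys yz].
    by rewrite orth // eq_sym.
  rewrite -[RHS]mul1r -(sum1 a Pa) mulr_suml (bigD1_seq z) //=.
  by rewrite big_seq_cond big1 ?addr0 // => y /andP[ys yz]; rewrite orth.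
apply: (rho_eq0_nilpotent _ _ _ hnrm _ _ (m + m)).
(* Split 1 into the idempotents [e_z(b) = e_z(a)] and move each of them inside
   the iterate; on it both [b - z] and [a - z] have vanishing [m]-th power. *)
rewrite -[LHS]mul1r -{1}(sum1 b Pb) mulr_suml big_seq big1 // => z zs.
rewrite -[LHS]mulr1 -iter_Cop_intertwine ?horner_alg_comm ?mulr1 ?mul1r //.
have <- : Cop (b - z%:A) (a - z%:A) = Cop b a.
  by apply/funext => x; exact: Cop_shift.
have powE (c : A) i : (c - z%:A) ^+ i = horner_alg c (('X - z%:P) ^+ i).
  by rewrite rmorphXn /= horner_algXsubC.
apply: iter_Cop_eq0 => i j mij; rewrite !powE; have [mi|im] := leqP m i.
  by rewrite -[horner_alg b _ * _]rmorphM /= (kill b z i) // mul0r.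
rewrite -mulrA -eab // -[horner_alg a _ * _]rmorphM /= mulrC.
by rewrite (kill a z j) ?mulr0 //; lia.
Qed.

Theorem corollary3p4 (R : realType) (A : algType R[i]) (nrm : A -> R)
  (hnrm : banach_algebra_norm nrm) (hA : semisimple A)
  (a b : A) (ha : Soc A a) (hb : Soc A b) :
  rho nrm a b = 0%:E <-> rho nrm b a = 0%:E.
Proof.
have [p p0 pa] := Soc_algebraic _ _ _ ha.
have [q q0 qb] := Soc_algebraic _ _ _ hb.
split; [exact: rho_eq0_algebraic_sym pa qb|exact: rho_eq0_algebraic_sym qb pa].
Qed.
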